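(* Given $A\in\mathbb C^{m_{dg}\times n}$, a nonzero row vector $v\in\mathbb C^{1\times n}$ and $\epsilon>0$, let $$y=\left\|v\begin{bmatrix}A\\ \epsilon I\end{bmatrix}^\dagger\right\|_2^2\qquad\text{and}\qquad\hat y=\left\|(v+\Delta v)\begin{bmatrix}A+\Delta A\\ \epsilon I\end{bmatrix}^\dagger\right\|_2^2$$ for some $\Delta A\in\mathbb C^{m_{dg}\times n}$ and $\Delta v\in\mathbb C^{1\times n}$ with $\|\Delta A\|_2\le u\,C_{\mathrm{alg}}\|A\|_2$ and $\|\Delta v\|_2\le u\,C_{\mathrm{alg}}\|v\|_2$, with $C_{\mathrm{alg}}>0$. Let $\epsilon=\alpha\,u\,C_{\mathrm{alg}}\|A\|_2$ for some $0<\alpha<(u\,C_{\mathrm{alg}})^{-1}$. Then $$\left|\frac{y-\hat y}{y}\right|\le\frac{4+2\sqrt2}{\alpha}+\frac{6+4\sqrt2}{\alpha^2}.$$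
   Context: $\|\cdot\|_2$ denotes the Euclidean norm for vectors and the spectral norm for matrices; $^\dagger$ is the Moore–Penrose inverse; $I$ is the $n\times n$ identity matrix; $u>0$ is the unit roundoff. *)

(* Defs.v *)
From mathcomp Require Import all_boot all_order all_algebra.
From mathcomp Require Import boolp classical_sets reals.
From mathcomp Require Export complex.

Set Implicit Arguments.
Unset Strict Implicit.
Unset Printing Implicit Defensive.

Import Order.TTheory GRing.Theory Num.Theory.
Local Open Scope classical_set_scope.
Local Open Scope ring_scope.
Local Open Scope complex_scope.
Local Open Scope sesquilinear_scope.

(* [normc z : R] is the modulus of [z : R[i]] as a real number, whereas [`|z|]
   is the same number seen in [R[i]]. *)
Definition l2norm (R : realType) (I : finType) (x : I -> R[i]) : R :=
  Num.sqrt (\sum_i ComplexField.Normc.normc (x i) ^+ 2).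

Definition rvnorm (R : realType) (n : nat) (v : 'rV[R[i]]_n) : R :=
  l2norm (fun j => v 0 j).

Definition cvnorm (R : realType) (n : nat) (x : 'cV[R[i]]_n) : R :=
  l2norm (fun i => x i 0).

(* The operator norm induced by the Euclidean norms. The unit ball (rather than
   the unit sphere) keeps the set nonempty when n = 0; the set is always bounded
   ([specnorm_has_sup]), so [sup] does not take its default value. *)
Definition specnorm (R : realType) (m n : nat) (A : 'M[R[i]]_(m, n)) : R :=
  sup [set cvnorm (A *m x) | x in [set x : 'cV[R[i]]_n | cvnorm x <= 1]].

Definition penrose (R : realType) (m n : nat) (A : 'M[R[i]]_(m, n))
    (X : 'M[R[i]]_(n, m)) : Prop :=
  [/\ A *m X *m A = A, X *m A *m X = X,
      (A *m X) ^t* = A *m X & (X *m A) ^t* = X *m A].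

(* The default value 0 is never used: see [mpinvP] and [mpinv_unique]. This is
   not [pinvmx], which is only some generalized inverse. *)
Definition mpinv (R : realType) (m n : nat) (A : 'M[R[i]]_(m, n)) :
    'M[R[i]]_(n, m) :=
  xget 0 [set X | penrose A X].

Lemma penrose_unique (R : realType) (m n : nat) (A : 'M[R[i]]_(m, n))
    (X Y : 'M[R[i]]_(n, m)) : penrose A X -> penrose A Y -> X = Y.
Proof.
move=> [X1 X2 X3 X4] [Y1 Y2 Y3 Y4].
have tM p q r (U : 'M[R[i]]_(p, q)) (V : 'M[R[i]]_(q, r)) :
  (U *m V) ^t* = V ^t* *m U ^t* by rewrite trmx_mul map_mxM.
have EX : A *m X = A *m Y.
  by rewrite -[LHS]X3 -[in LHS]Y1 -[_ *m A *m X]mulmxA tM X3 Y3 mulmxA X1.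
have EY : X *m A = Y *m A.
  by rewrite -[LHS]X4 -[in LHS]Y1 -[A *m Y *m A]mulmxA mulmxA tM X4 Y4 -mulmxA
    (mulmxA A X) X1.
by rewrite -X2 EY -mulmxA EX mulmxA Y2.
Qed.

Lemma gram_unit (R : realType) (k n : nat) (B : 'M[R[i]]_(k, n)) :
  row_free B -> B *m B ^t* \in unitmx.
Proof.
move=> Bfree; rewrite -row_free_unit; apply/inj_row_free => v vBB0.
have vB0 : v *m B = 0.
  suff h : dotmx (v *m B) (v *m B) == 0 by move: h; rewrite dnorm_eq0 => /eqP.
  by rewrite dotmxE trmx_mul map_mxM mulmxA -(mulmxA v) vBB0 !mul0mx mxE.
by apply/eqP; rewrite -(mulmx_free_eq0 v Bfree) vB0.
Qed.

Lemma penrose_exists (R : realType) (m n : nat) (A : 'M[R[i]]_(m, n)) :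
  exists X, penrose A X.
Proof.
have tM p q r (U : 'M[R[i]]_(p, q)) (V : 'M[R[i]]_(q, r)) :
  (U *m V) ^t* = V ^t* *m U ^t* by rewrite trmx_mul map_mxM.
have tV p (U : 'M[R[i]]_p) : (invmx U) ^t* = invmx (U ^t*).
  by rewrite trmx_inv map_invmx.
rewrite -(mulmx_base A); move: (col_base_full A) (row_base_free A).
move: (\rank A) (col_base A) (row_base A) => k C F Cfull Ffree {A}.
have Fu : F *m F ^t* \in unitmx by exact: gram_unit.
have Cu : C ^t* *m C \in unitmx.
  have := @gram_unit R _ _ (C ^t*); rewrite trmxCK; apply.
  by rewrite row_free_map /row_free mxrank_tr.
have FV := mulmxV Fu; have CV := mulVmx Cu.
have FT : (invmx (F *m F ^t*)) ^t* = invmx (F *m F ^t*).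
  by rewrite tV tM trmxCK.
have CT : (invmx (C ^t* *m C)) ^t* = invmx (C ^t* *m C).
  by rewrite tV tM trmxCK.
move: (trmxCK C) (trmxCK F) FV CV FT CT.
move: (invmx (F *m F ^t*)) (invmx (C ^t* *m C)) => G H.
move EC: (C ^t*) => Cs; move EF: (F ^t*) => Fs => CsT FsT FV CV GT HT.
have AX : C *m F *m (Fs *m G *m (H *m Cs)) = C *m H *m Cs.
  by rewrite -(mulmxA C) (mulmxA F) (mulmxA F) FV mul1mx mulmxA.
have XA : Fs *m G *m (H *m Cs) *m (C *m F) = Fs *m G *m F.
  by rewrite -(mulmxA (Fs *m G)) (mulmxA (H *m Cs)) -(mulmxA H) CV mul1mx.
exists (Fs *m G *m (H *m Cs)); split.
- by rewrite AX (mulmxA _ C F) -(mulmxA _ Cs C) -(mulmxA C H) CV mulmx1.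
- by rewrite XA mulmxA -(mulmxA _ F (Fs *m G)) (mulmxA F Fs G) FV mulmx1.
- by rewrite AX !tM HT CsT EC mulmxA.
- by rewrite XA !tM GT FsT EF mulmxA.
Qed.

Lemma mpinvP (R : realType) (m n : nat) (A : 'M[R[i]]_(m, n)) :
  penrose A (mpinv A).
Proof. exact: (xgetPex 0 (penrose_exists A)). Qed.

Lemma mpinv_unique (R : realType) (m n : nat) (A : 'M[R[i]]_(m, n))
    (X : 'M[R[i]]_(n, m)) : penrose A X -> mpinv A = X.
Proof. by move=> AX; apply: penrose_unique AX; exact: mpinvP. Qed.

Lemma specnorm_has_sup (R : realType) (m n : nat) (A : 'M[R[i]]_(m, n)) :
  has_sup [set cvnorm (A *m x) | x in [set x : 'cV[R[i]]_n | cvnorm x <= 1]].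
Proof.
split.
  exists (cvnorm (A *m 0)), 0 => //=; rewrite /cvnorm /l2norm.
  by rewrite big1 ?sqrtr0 // => i _; rewrite mxE ComplexField.Normc.normc0 expr0n.
exists (Num.sqrt
  (\sum_i (\sum_j ComplexField.Normc.normc (A i j)) ^+ 2)) => _ [x /= x1 <-].
have n0 (z : R[i]) : 0 <= ComplexField.Normc.normc z.
  by case: z => a b; exact: sqrtr_ge0.
have xj j : ComplexField.Normc.normc (x j 0) <= 1.
  apply: le_trans x1; rewrite -[leLHS]ger0_norm // -sqrtr_sqr ler_wsqrtr //.
  by rewrite (bigD1 j) //= lerDl sumr_ge0 // => i _; rewrite sqr_ge0.
rewrite ler_wsqrtr // ler_sum // => i _.
rewrite lerXn2r ?nnegrE ?n0 ?sumr_ge0 // mxE.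
elim/big_ind2: _ => [|a b c d ab cd|j _].
- by rewrite ComplexField.Normc.normc0.
- by rewrite (le_trans (le_normcD _ _)) // lerD.
- by rewrite ComplexField.Normc.normcM ler_piMr.
Qed.

(* Main.v *)
Require Import Defs.
From mathcomp Require Import all_boot all_order all_algebra.
From mathcomp Require Import classical_sets reals complex.
From mathcomp Require Import ring lra.

Set Implicit Arguments.
Unset Strict Implicit.
Unset Printing Implicit Defensive.

Import Order.TTheory GRing.Theory Num.Theory.
Local Open Scope ring_scope.
Local Open Scope complex_scope.
Local Open Scope sesquilinear_scope.

(** Write B for the regularized matrix [A; eps I] and B' for its perturbation,
which differs from B only in the upper block, by dA. Since eps > 0, B has a left
inverse, namely its pseudo-inverse B^+, so that w = v B^+ satisfies w B = v. Put
s = |w| and t = |(v + dv) B'^+|, whose squares are y and yhat.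

The data are pushed through w: if a is the part of w that multiplies A, then
  v + dv = w B' - a dA + dv.
Apply B'^+ on the right. The first term becomes w (B' B'^+), no longer than w
because B' B'^+ is an orthogonal projector ([rvnorm_mulmx_mpinv_le]); the norms
of the other two grow by a factor at most 1 / eps ([rvnorm_mpinv_regularized_le]). Hence
  t <= s + (|dA| s + |dv|) / eps   ([rvnorm_mpinv_regularized_perturb]),
and exchanging the two problems gives s <= t + (|dA| t + |dv|) / eps.

With eps = alpha u Calg |A|, the first error term is at most s / alpha (or
t / alpha). For the second, the condition alpha < 1 / (u Calg) says eps <= |A|,
so B has norm at most sqrt 2 |A| and |v| = |w B| <= sqrt 2 |A| s
([rvnorm_le_mpinv_regularized]); hence |dv| / eps <= sqrt 2 s / alpha.

With delta = (1 + sqrt 2) / alpha this yields t <= (1 + delta) s, and also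
s - t <= delta s when t < s, so |s^2 - t^2| <= (2 delta + delta^2) s^2
([rel_sqr_diff_le]). This is
(2 + 2 sqrt 2) / alpha + (3 + 2 sqrt 2) / alpha^2, below the stated bound. *)

(** * The Euclidean norm of row vectors *)

Lemma rvnorm_ge0 (R : realType) (n : nat) (v : 'rV[R[i]]_n) : 0 <= rvnorm v.
Proof. exact: sqrtr_ge0. Qed.

(** Transfers to the real-valued norm what is known of the complex-valued
hermitian product. *)
Lemma sqr_rvnorm (R : realType) (n : nat) (v : 'rV[R[i]]_n) :
  (rvnorm v ^+ 2)%:C = dotmx v v.
Proof.
rewrite /rvnorm /l2norm sqr_sqrtr ?sumr_ge0 // => [|i _]; last exact: sqr_ge0.
rewrite dotmxE mxE rmorph_sum /=; apply: eq_bigr => i _.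
by rewrite !mxE rmorphXn /= -/(`|v 0 i|) -normCK.
Qed.

Lemma sqrtC_dotmx (R : realType) (n : nat) (v : 'rV[R[i]]_n) :
  sqrtC (dotmx v v) = (rvnorm v)%:C.
Proof. by rewrite -sqr_rvnorm rmorphXn /= sqrCK // lecR rvnorm_ge0. Qed.

Lemma norm_dotmx (R : realType) (n : nat) (v w : 'rV[R[i]]_n) :
  `|dotmx v w| <= (rvnorm v * rvnorm w)%:C.
Proof.
rewrite rmorphM /= -!sqrtC_dotmx.
exact: (leif_le (CauchySchwarz_sqrt (@dotmx _ n) v w)).
Qed.

Lemma rvnormD (R : realType) (n : nat) (v w : 'rV[R[i]]_n) :
  rvnorm (v + w) <= rvnorm v + rvnorm w.
Proof.
rewrite -lecR rmorphD /= -!sqrtC_dotmx.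
exact: (leif_le (triangle_lerif (@dotmx _ n) v w)).
Qed.

Lemma rvnormZ (R : realType) (n : nat) (c : R) (v : 'rV[R[i]]_n) :
  0 <= c -> rvnorm (c%:C *: v) = c * rvnorm v.
Proof.
move=> c0; apply/eqP; rewrite -(@eqrXn2 _ 2) ?rvnorm_ge0 ?mulr_ge0 ?rvnorm_ge0 //.
apply/eqP/complexI; rewrite sqr_rvnorm exprMn rmorphM /= sqr_rvnorm.
rewrite (dnormZ (@dotmx _ n) c%:C v).
by rewrite ger0_norm ?lecR // rmorphXn.
Qed.

Lemma conjC_real_complex (R : realType) (c : R) : Num.conj (c%:C : R[i]) = c%:C.
Proof. exact: conjc_real. Qed.

Lemma rvnormN (R : realType) (n : nat) (v : 'rV[R[i]]_n) :
  rvnorm (- v) = rvnorm v.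
Proof.
apply/eqP; rewrite -(@eqrXn2 _ 2) ?rvnorm_ge0 //.
by apply/eqP/complexI; rewrite !sqr_rvnorm hnormN.
Qed.

Lemma sqr_rvnorm_row_mx (R : realType) (m n : nat)
    (v : 'rV[R[i]]_m) (w : 'rV[R[i]]_n) :
  rvnorm (row_mx v w) ^+ 2 = rvnorm v ^+ 2 + rvnorm w ^+ 2.
Proof.
apply: complexI; rewrite rmorphD /= !sqr_rvnorm !dotmxE.
by rewrite tr_row_mx map_col_mx mul_row_col mxE.
Qed.

Lemma cvnorm_rvnorm (R : realType) (n : nat) (x : 'cV[R[i]]_n) :
  cvnorm x = rvnorm (x ^t*).
Proof.
congr Num.sqrt; apply: eq_bigr => i _; rewrite !mxE; congr (_ ^+ 2).
by apply: complexI; exact: esym (norm_conjC (x i 0)).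
Qed.

Lemma rvnorm_eq0 (R : realType) (n : nat) (v : 'rV[R[i]]_n) :
  (rvnorm v == 0) = (v == 0).
Proof.
by rewrite -sqrf_eq0 -(inj_eq (@complexI R)) sqr_rvnorm dnorm_eq0.
Qed.

(** The duality argument behind the bounds on operators acting on rows: |p|^2 is
a product of two rows in which Cauchy-Schwarz leaves one factor |p|, and that
factor cancels. *)
Lemma rvnorm_le_of_dotmx (R : realType) (n k : nat) (p : 'rV[R[i]]_n)
    (z1 z2 : 'rV[R[i]]_k) (c : R) :
  dotmx p p = dotmx z1 z2 -> rvnorm z1 * rvnorm z2 <= c * rvnorm p ->
  0 <= c -> rvnorm p <= c.
Proof.
move=> pz zc c0; have [->//|p0] := eqVneq (rvnorm p) 0.
rewrite -(@ler_pM2r _ (rvnorm p)) ?lt_def ?p0 ?rvnorm_ge0 //.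
apply: le_trans zc; rewrite -expr2 -lecR sqr_rvnorm pz.
apply: le_trans (norm_dotmx z1 z2).
by rewrite -pz ger0_norm // (dnorm_ge0 (@dotmx _ n)).
Qed.

(** * The spectral norm *)

Lemma specnorm_ge0 (R : realType) (m n : nat) (A : 'M[R[i]]_(m, n)) :
  0 <= specnorm A.
Proof.
have [[y Sy] ubA] := specnorm_has_sup A.
apply: le_trans (ub_le_sup ubA Sy).
by case: Sy => x _ <-; exact: sqrtr_ge0.
Qed.

Lemma specnormN (R : realType) (m n : nat) (A : 'M[R[i]]_(m, n)) :
  specnorm (- A) = specnorm A.
Proof.
rewrite /specnorm; congr sup; apply: eq_imagel => x _.
by rewrite mulNmx !cvnorm_rvnorm linearN /= map_mxN rvnormN.
Qed.

Lemma cvnorm_mulmx_le (R : realType) (m n : nat) (A : 'M[R[i]]_(m, n))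
    (x : 'cV[R[i]]_n) :
  cvnorm (A *m x) <= specnorm A * cvnorm x.
Proof.
have cvnormZ k (c : R) (z : 'cV[R[i]]_k) : 0 <= c ->
    cvnorm (c%:C *: z) = c * cvnorm z.
  move=> c0; rewrite !cvnorm_rvnorm linearZ /= map_mxZ /= conjC_real_complex.
  exact: rvnormZ.
have [x0|x0] := eqVneq (cvnorm x) 0.
  have xt0 : x ^t* = 0 by apply/eqP; rewrite -rvnorm_eq0 -cvnorm_rvnorm x0.
  have -> : A *m x = 0 by rewrite -[x]trmxCK xt0 linear0 map_mx0 mulmx0.
  rewrite x0 mulr0 cvnorm_rvnorm linear0 map_mx0 le_eqVlt.
  by rewrite (rvnorm_eq0 (0 : 'rV_m)) eqxx.
have xp : 0 < cvnorm x by rewrite lt_def x0; exact: sqrtr_ge0.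
rewrite -ler_pdivrMr // mulrC -cvnormZ ?invr_ge0 ?(ltW xp) // scalemxAr.
have [_ ubA] := specnorm_has_sup A; apply: (ub_le_sup ubA).
exists ((cvnorm x)^-1%:C *: x) => //=.
by rewrite cvnormZ ?invr_ge0 ?(ltW xp) // mulVf.
Qed.

(** The spectral norm is defined through columns, x |-> A x; it bounds the action
on rows as well, because |w A|^2 is the product of w with A (w A)^*. *)
Lemma rvnorm_mulmx_le (R : realType) (m n : nat) (A : 'M[R[i]]_(m, n))
    (w : 'rV[R[i]]_m) :
  rvnorm (w *m A) <= specnorm A * rvnorm w.
Proof.
have S0 := specnorm_ge0 A; have w0 := rvnorm_ge0 w.
apply: (@rvnorm_le_of_dotmx _ _ _ _ w ((A *m (w *m A) ^t*) ^t*)).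
- by rewrite !dotmxE trmxCK mulmxA.
- rewrite -cvnorm_rvnorm.
  apply: (le_trans (ler_wpM2l w0 (cvnorm_mulmx_le _ _))).
  by rewrite cvnorm_rvnorm trmxCK mulrCA mulrA.
- exact: mulr_ge0.
Qed.

(** * The pseudo-inverse of a regularized matrix *)

(** B B^+ is hermitian and idempotent, so the squared norm of w B B^+ is its
product with w. *)
Lemma rvnorm_mulmx_mpinv_le (R : realType) (m n : nat) (B : 'M[R[i]]_(m, n))
    (w : 'rV[R[i]]_m) :
  rvnorm (w *m B *m mpinv B) <= rvnorm w.
Proof.
have [BXB _ BXt _] := mpinvP B.
apply: (@rvnorm_le_of_dotmx _ _ _ _ (w *m B *m mpinv B) w); rewrite ?rvnorm_ge0 //.
  rewrite !dotmxE -mulmxA trmx_mul map_mxM BXt !mulmxA.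
  by rewrite -3!(mulmxA w) BXB.
by rewrite mulrC.
Qed.

(** Stacking eps I below A makes every singular value at least eps. *)
Local Notation regularized A eps := (col_mx A (eps%:C)%:M).

(** The lower block of B B^+ B = B reads eps B^+ B = eps I. *)
Lemma mpinv_regularizedK (R : realType) (m n : nat) (A : 'M[R[i]]_(m, n))
    (eps : R) :
  0 < eps -> mpinv (regularized A eps) *m regularized A eps = 1%:M.
Proof.
move=> eps_gt0; have [BXB _ _ _] := mpinvP (regularized A eps).
have e0 : eps%:C != 0 :> R[i] by rewrite (inj_eq (@complexI R)) gt_eqF.
have := congr1 dsubmx BXB.
rewrite -mulmxA mul_col_mx !col_mxKd mul_scalar_mx.
move=> /(congr1 (fun M => (eps%:C)^-1 *: M)).
by rewrite scale_scalar_mx scalerA mulVf // scale1r.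
Qed.

(** The pseudo-inverse of B has norm at most 1 / eps. Its rows lie in the row space
of B^*, so w = v B^+ is of the form z B^*, whose lower part is eps z: thus
eps |z| <= |w|. On the other hand |w|^2 is the product of v = w B with z. *)
Lemma rvnorm_mpinv_regularized_le (R : realType) (m n : nat)
    (A : 'M[R[i]]_(m, n)) (eps : R) (v : 'rV[R[i]]_n) :
  0 < eps -> rvnorm (v *m mpinv (regularized A eps)) <= rvnorm v / eps.
Proof.
move=> eps_gt0; set B := regularized A eps; set w := v *m mpinv B.
have [_ XBX BXt _] := mpinvP B.
pose z := w *m (mpinv B) ^t*.
have wE : w = z *m B ^t*.
  rewrite /z -mulmxA -map_mxM -trmx_mul BXt /w.
  by rewrite -[in LHS]XBX !mulmxA.
have wB : w *m B = v by rewrite -mulmxA mpinv_regularizedK ?mulmx1.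
have zw : eps * rvnorm z <= rvnorm w.
  rewrite -(@ler_pXn2r _ 2) // ?nnegrE ?mulr_ge0 ?rvnorm_ge0 ?(ltW eps_gt0) //.
  rewrite [in leRHS]wE tr_col_mx map_row_mx mul_mx_row sqr_rvnorm_row_mx.
  rewrite tr_scalar_mx map_scalar_mx /= conjC_real_complex mul_mx_scalar.
  rewrite rvnormZ ?(ltW eps_gt0) //.
  by rewrite lerDr sqr_ge0.
apply: (@rvnorm_le_of_dotmx _ _ _ _ v z).
- have wt : w ^t* = B *m z ^t* by rewrite wE trmx_mul map_mxM trmxCK.
  by rewrite !dotmxE wt mulmxA wB.
- by rewrite -mulrA ler_wpM2l ?rvnorm_ge0 // ler_pdivlMl.
- by rewrite divr_ge0 ?rvnorm_ge0 ?ltW.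
Qed.

(** The norm of B is at most sqrt (|A|^2 + eps^2) <= sqrt 2 |A|, and v = w B for
w = v B^+, as soon as eps <= |A|. *)
Lemma rvnorm_le_mpinv_regularized (R : realType) (m n : nat)
    (A : 'M[R[i]]_(m, n)) (eps : R) (v : 'rV[R[i]]_n) :
  0 < eps -> eps <= specnorm A ->
  rvnorm v <=
    Num.sqrt 2 * specnorm A * rvnorm (v *m mpinv (regularized A eps)).
Proof.
move=> eps_gt0 eps_le; set B := regularized A eps; set w := v *m mpinv B.
have wB : w *m B = v by rewrite -mulmxA mpinv_regularizedK ?mulmx1.
rewrite -[in leLHS]wB -[w in leLHS]hsubmxK mul_row_col mul_mx_scalar.
have := sqr_rvnorm_row_mx (lsubmx w) (rsubmx w); rewrite hsubmxK.
set a := lsubmx w; set b := rsubmx w => wab.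
have s0 := specnorm_ge0 A.
have a0 := rvnorm_ge0 a; have b0 := rvnorm_ge0 b; have w0 := rvnorm_ge0 w.
apply: (@le_trans _ _ (specnorm A * (rvnorm a + rvnorm b))).
  rewrite mulrDr; apply: (le_trans (rvnormD _ _)); apply: lerD.
    exact: rvnorm_mulmx_le.
  by rewrite rvnormZ ?(ltW eps_gt0) // ler_wpM2r.
rewrite -mulrA mulrCA; apply: ler_wpM2l => //.
rewrite -(@ler_pXn2r _ 2) // ?nnegrE ?addr_ge0 ?mulr_ge0 ?sqrtr_ge0 //.
rewrite exprMn sqr_sqrtr // wab.
by have := sqr_ge0 (rvnorm a - rvnorm b); nra.
Qed.

(** * Perturbation *)

(** The new row vector is expressed through the old solution w = v B^+ and the new
matrix B', as w B' plus a small residual; the lower blocks of B and B' agree, so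
only the upper part of w meets dA. *)
Lemma rvnorm_mpinv_regularized_perturb (R : realType) (m n : nat)
    (A dA : 'M[R[i]]_(m, n)) (v dv : 'rV[R[i]]_n) (eps : R) :
  0 < eps ->
  rvnorm ((v + dv) *m mpinv (regularized (A + dA) eps)) <=
    rvnorm (v *m mpinv (regularized A eps)) +
    (specnorm dA * rvnorm (v *m mpinv (regularized A eps)) + rvnorm dv) / eps.
Proof.
move=> eps_gt0; set B := regularized A eps; set B' := regularized (A + dA) eps.
set w := v *m mpinv B; set r := rvnorm w.
have wB : w *m B = v by rewrite -mulmxA mpinv_regularizedK ?mulmx1.
pose a := lsubmx w.
have vE : v + dv = w *m B' + (- (a *m dA) + dv).
  rewrite -[in LHS]wB -[w]hsubmxK !mul_row_col mulmxDr -/a.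
  by rewrite addrA; congr (_ + _); rewrite addrAC addrK.
have ar : rvnorm a <= r.
  rewrite -(@ler_pXn2r _ 2) // ?nnegrE ?rvnorm_ge0 //.
  by rewrite /r -[w]hsubmxK sqr_rvnorm_row_mx lerDl sqr_ge0.
rewrite [in leLHS]vE mulmxDl; apply: (le_trans (rvnormD _ _)).
apply: lerD; first exact: rvnorm_mulmx_mpinv_le.
apply: (le_trans (rvnorm_mpinv_regularized_le _ _ eps_gt0)).
rewrite ler_pM2r ?invr_gt0 //; apply: (le_trans (rvnormD _ _)).
rewrite lerD2r rvnormN; apply: (le_trans (rvnorm_mulmx_le _ _)).
by rewrite ler_wpM2l ?specnorm_ge0.
Qed.

(** The two hypotheses are not symmetric: the term in b is relative to s in both.
When t < s the second one gives s - t <= (a + b) s directly; dividing by 1 - a or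
1 - b would spoil the constants. *)
Lemma rel_sqr_diff_le (R : realType) (s t a b : R) :
  0 <= s -> 0 <= t -> 0 <= a -> 0 <= b ->
  t <= s + a * s + b * s -> s <= t + a * t + b * s ->
  `|(s ^+ 2 - t ^+ 2) / s ^+ 2| <= 2 * (a + b) + (a + b) ^+ 2.
Proof.
move=> s0 t0 a0 b0 ts st.
have rhs0 : 0 <= 2 * (a + b) + (a + b) ^+ 2.
  by rewrite addr_ge0 ?mulr_ge0 ?addr_ge0 ?sqr_ge0.
(* For s = 0 the quotient is 0 by convention. *)
have [->|sn0] := eqVneq s 0; first by rewrite expr0n invr0 mulr0 normr0.
have sp : 0 < s ^+ 2 by rewrite exprn_gt0 // lt_def sn0.
rewrite normrM normfV (ger0_norm (ltW sp)) ler_pdivrMr // ler_norml.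
apply/andP; split.
  have : t ^+ 2 <= (s + a * s + b * s) ^+ 2 by rewrite lerXn2r // nnegrE; nra.
  by lra.
have [lts|lst] := ltP t s; last by nra.
have : (s - t) * (s + t) <= ((a + b) * s) * (2 * s).
  apply: ler_pM; [lra|lra| |lra].
  have : a * t <= a * s by rewrite ler_wpM2l // ltW.
  by lra.
have : 0 <= (a + b) ^+ 2 * s ^+ 2 by rewrite mulr_ge0 ?sqr_ge0.
by nra.
Qed.

Theorem theorem31 (R : realType) (m n : nat)
    (A dA : 'M[R[i]]_(m, n)) (v dv : 'rV[R[i]]_n) (u Calg eps alpha : R) :
  0 < u -> 0 < Calg ->
  v != 0 ->
  0 < eps ->
  specnorm dA <= u * Calg * specnorm A ->
  rvnorm dv <= u * Calg * rvnorm v ->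
  0 < alpha -> alpha < (u * Calg)^-1 ->
  eps = alpha * u * Calg * specnorm A ->
  let y := rvnorm (v *m mpinv (col_mx A (eps%:C)%:M)) ^+ 2 in
  let yhat :=
    rvnorm ((v + dv) *m mpinv (col_mx (A + dA) (eps%:C)%:M)) ^+ 2 in
  `|(y - yhat) / y| <=
    (4 + 2 * Num.sqrt 2) / alpha + (6 + 4 * Num.sqrt 2) / alpha ^+ 2.
Proof.
move=> u0 C0 _ e0 dAle dvle al0 alt eE /=.
have uC0 : 0 < u * Calg by rewrite mulr_gt0.
have sA0 := specnorm_ge0 A.
pose tau := u * Calg * specnorm A.
have epsE : eps = alpha * tau by rewrite eE /tau !mulrA.
have eA : eps <= specnorm A.
  have auC : alpha * (u * Calg) < 1 by rewrite -ltr_pdivlMr // mul1r.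
  by rewrite epsE mulrA -[leRHS]mul1r ler_wpM2r // ltW.
have tauE : tau / eps = alpha^-1.
  have tau0 : tau != 0 by apply: contraTneq e0 => t0; rewrite epsE t0 mulr0 ltxx.
  by rewrite epsE invfM mulrCA mulfV // mulr1.
have vle := rvnorm_le_mpinv_regularized v e0 eA.
have := rvnorm_mpinv_regularized_perturb A dA v dv e0.
have := rvnorm_mpinv_regularized_perturb (A + dA) (- dA) (v + dv) (- dv) e0.
rewrite !addrK specnormN rvnormN.
set s := rvnorm (v *m _) in vle *; set t := rvnorm ((v + dv) *m _) => st ts.
have s0 : 0 <= s by exact: rvnorm_ge0.
have t0 : 0 <= t by exact: rvnorm_ge0.
have dvs : rvnorm dv / eps <= Num.sqrt 2 / alpha * s.
  rewrite -tauE mulrAC mulrA ler_pM2r ?invr_gt0 //.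
  apply: (le_trans dvle); rewrite /tau.
  apply: (le_trans (ler_wpM2l (ltW uC0) vle)).
  by rewrite le_eqVlt; apply/orP; left; apply/eqP; ring.
have dAs r : 0 <= r -> specnorm dA * r / eps <= alpha^-1 * r.
  by move=> r0; rewrite -tauE mulrAC ler_wpM2r // ler_pM2r ?invr_gt0.
have q0 : 0 <= Num.sqrt 2 :> R by exact: sqrtr_ge0.
have q2 : Num.sqrt 2 ^+ 2 = 2 :> R by rewrite sqr_sqrtr.
have i0 : 0 <= alpha^-1 by rewrite invr_ge0 ltW.
have b0 : 0 <= Num.sqrt 2 / alpha by rewrite mulr_ge0.
apply: (le_trans (rel_sqr_diff_le s0 t0 i0 b0 _ _)).
- by have := dAs _ s0; move: ts dvs; rewrite mulrDl; lra.
- by have := dAs _ t0; move: st dvs; rewrite mulrDl; lra.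
rewrite -exprVn.
have : 0 <= alpha^-1 ^+ 2 by rewrite sqr_ge0.
have : 0 <= Num.sqrt 2 * alpha^-1 ^+ 2 by rewrite mulr_ge0 ?sqr_ge0.
have : (alpha^-1 + Num.sqrt 2 / alpha) ^+ 2 =
    (3 + 2 * Num.sqrt 2) * alpha^-1 ^+ 2.
  have -> : 3 = 1 + Num.sqrt 2 ^+ 2 :> R by rewrite q2; ring.
  by ring.
by lra.
Qed.
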